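(* In the two-bus setting of the context, fix $\mu=(g,b_c,\bar t,\theta_{\mathrm s})$ satisfying the standing assumptions. Suppose there exists $\epsilon=(\epsilon_1,\epsilon_2)$ with $0\le\epsilon_1\le 1-k_1^-$ and $0\le\epsilon_2<1-k_2^-$ such that $$\frac{-k_\mu\gamma_P}{1-k_2^--\epsilon_2}+\frac{\gamma_P}{1-k_2^-}+\rho\,(1+k_2^-+\epsilon_2)+\tilde\rho\le\epsilon_1,$$ $$\frac{-k_\mu\gamma_Q}{1-k_2^--\epsilon_2}+(1-k_2^-)+\tilde\rho\,(k_1^-+\epsilon_1)-\sqrt{1-(k_1^-+\epsilon_1)^2}\le\epsilon_2.$$ Then the set $\mathcal A_\epsilon^-=\{(\psi,x)\in\mathbb{R}^2:|\psi|\le k_1^-+\epsilon_1,\ |x|\le k_2^-+\epsilon_2\}$ is $F_\mu$-invariant (i.e. $F_\mu$ is well defined on it and $F_\mu(\mathcal A_\epsilon^-)\subseteq\mathcal A_\epsilon^-$), and the two-bus system possesses a power flow solution in $\mathcal A_\epsilon^-$.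
   Context: Two-bus system. Fixed real data: series susceptance $b>0$, generator (slack) voltage $V_2>0$, load injections $\bar P_1,Q_1$. The perturbation vector is $\mu=(g,b_c,\bar t,\theta_{\mathrm s})\in\mathbb{R}^4$ (series conductance, shunt susceptance, transformer tap ratio minus one, transformer phase shift), with $\bar t>-1$. Define $$\tilde g=\frac{g\cos\theta_{\mathrm s}-b\sin\theta_{\mathrm s}}{\bar t+1},\quad \tilde b=\frac{b\cos\theta_{\mathrm s}+g\sin\theta_{\mathrm s}}{\bar t+1},\quad \hat b=b-\frac{b_c}{2},\quad \rho=\frac{g}{\hat b},\quad \tilde\rho=\frac{\tilde g}{\tilde b},\quad k_\mu=\frac{b\hat b}{\tilde b^2}.$$ Loading margins: $\gamma_P=\bar P_1/(bV_2^2)$, $\gamma_Q=Q_1/(bV_2^2)$. Standing assumptions on $\mu$: $\bar t>-1$, $\hat b>0$, $\tilde b>0$, $\rho\ge0$, $\tilde\rho\ge0$. Standing assumptions on loading: $\gamma_P<0$, $\gamma_Q\le0$ (active load, inductive), and $0<4\gamma_P^2-4\gamma_Q<1$. Constants: $k_2^-=1-\sqrt{\tfrac12+\gamma_Q+\sqrt{\tfrac14+\gamma_Q-\gamma_P^2}}$ and $k_1^-=-\gamma_P/(1-k_2^-)$. The map $F_\mu$: for $\xi=(\psi,x)$ with $|\psi|\le1$, $x>-1$, $F_\mu(\xi)=(\psi^+,x^+)$, where $$\psi^+=\frac{-k_\mu\gamma_P}{x+1}+\rho(x+1)-\tilde\rho\sqrt{1-\psi^2},\qquad x^+=\frac{k_\mu\gamma_Q}{x+1}-\tilde\rho\,\psi^++\sqrt{1-(\psi^+)^2}-1,$$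 defined when $|\psi^+|\le1$. Here $\psi$ is the sine of the branch phase difference and $x=v-1$ with $v$ the normalized load voltage magnitude; a power flow solution of the two-bus system in a set means a fixed point of $F_\mu$ in that set. *)

(* Defs.v *)
From Stdlib Require Import Reals.

Open Scope R_scope.

Record two_bus := TwoBus {
  series_b : R;   (* series susceptance b *)
  slack_V  : R;   (* slack voltage V_2 *)
  load_P   : R;   (* active load injection \bar P_1 *)
  load_Q   : R    (* reactive load injection Q_1 *)
}.

(* mu = (g, b_c, \bar t, theta_s) in R^4; \bar t is the tap ratio minus one. *)
Record perturbation := Perturbation {
  series_g : R;
  shunt_b  : R;
  tap      : R;
  shift    : R
}.

Definition tilde_g (N : two_bus) (mu : perturbation) : R :=
  (series_g mu * cos (shift mu) - series_b N * sin (shift mu)) / (tap mu + 1).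

Definition tilde_b (N : two_bus) (mu : perturbation) : R :=
  (series_b N * cos (shift mu) + series_g mu * sin (shift mu)) / (tap mu + 1).

Definition hat_b (N : two_bus) (mu : perturbation) : R :=
  series_b N - shunt_b mu / 2.

Definition rho (N : two_bus) (mu : perturbation) : R :=
  series_g mu / hat_b N mu.

Definition tilde_rho (N : two_bus) (mu : perturbation) : R :=
  tilde_g N mu / tilde_b N mu.

Definition k_mu (N : two_bus) (mu : perturbation) : R :=
  series_b N * hat_b N mu / (tilde_b N mu) ^ 2.

Definition gamma_P (N : two_bus) : R := load_P N / (series_b N * (slack_V N) ^ 2).
Definition gamma_Q (N : two_bus) : R := load_Q N / (series_b N * (slack_V N) ^ 2).

Definition k2m (N : two_bus) : R :=
  1 - sqrt (1 / 2 + gamma_Q N + sqrt (1 / 4 + gamma_Q N - (gamma_P N) ^ 2)).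

Definition k1m (N : two_bus) : R := - gamma_P N / (1 - k2m N).

Definition psi_next (N : two_bus) (mu : perturbation) (xi : R * R) : R :=
  let (psi, x) := xi in
  - k_mu N mu * gamma_P N / (x + 1) + rho N mu * (x + 1)
  - tilde_rho N mu * sqrt (1 - psi ^ 2).

(* The second component uses the updated psi, not the current one. *)
Definition x_next (N : two_bus) (mu : perturbation) (xi : R * R) : R :=
  k_mu N mu * gamma_Q N / (snd xi + 1)
  - tilde_rho N mu * psi_next N mu xi
  + sqrt (1 - (psi_next N mu xi) ^ 2) - 1.

(* F_mu is a partial map: F gives its values, which are meaningful only on
   F_dom (elsewhere sqrt and division take default values). *)
Definition F_dom (N : two_bus) (mu : perturbation) (xi : R * R) : Prop :=
  Rabs (fst xi) <= 1 /\ snd xi > -1 /\ Rabs (psi_next N mu xi) <= 1.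

Definition F (N : two_bus) (mu : perturbation) (xi : R * R) : R * R :=
  (psi_next N mu xi, x_next N mu xi).

Definition F_invariant (N : two_bus) (mu : perturbation) (A : R * R -> Prop) : Prop :=
  forall xi, A xi -> F_dom N mu xi /\ A (F N mu xi).

Definition power_flow_solution (N : two_bus) (mu : perturbation) (xi : R * R) : Prop :=
  F_dom N mu xi /\ F N mu xi = xi.

Definition Aset (N : two_bus) (eps1 eps2 : R) (xi : R * R) : Prop :=
  Rabs (fst xi) <= k1m N + eps1 /\ Rabs (snd xi) <= k2m N + eps2.

(* Main.v *)
Require Import Defs.
From Stdlib Require Import Reals Ranalysis5 Lra Psatz.

Open Scope R_scope.

(** Put [m = 1 - k2^- - eps2]. The second condition says
    [m - k gamma_Q / m <= c(psi)] for all [|psi| <= k1^- + eps1], where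
    [c(psi) = sqrt (1 - psi^2) - tilde_rho psi]; invariance follows from
    monotonicity in each term. Brouwer's theorem is avoided: for fixed [psi]
    the second fixed-point equation is [u - k gamma_Q / u = c(psi)] in
    [u = x + 1], whose larger root is a continuous function of [psi] with
    values in [[m, c(psi)]]. Substituting it in the first equation leaves a
    continuous self-map of an interval. *)

(** The intermediate value theorem for [t - f t]. Fixed endpoints are split off first, because
    [IVT_interv] asks for strict signs at both ends. *)
Lemma interval_fixed_point (f : R -> R) (a b : R) :
  a <= b ->
  (forall t, a <= t <= b -> continuity_pt f t) ->
  (forall t, a <= t <= b -> a <= f t <= b) ->
  exists t, a <= t <= b /\ f t = t.
Proof.
  intros hab hc hf.
  destruct (Req_dec (f a) a) as [ha | ha]; [exists a; lra |].
  destruct (Req_dec (f b) b) as [hb | hb]; [exists b; lra |].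
  assert (hfa := hf a ltac:(lra)). assert (hfb := hf b ltac:(lra)).
  assert (a < b) by (destruct (Req_dec a b); [subst; lra | lra]).
  destruct (IVT_interv (fun t => t - f t) a b) as [t [ht1 ht2]]; try lra.
  - intros t ht.
    apply (continuity_pt_minus (fun t => t) f t); [| now apply hc].
    apply derivable_continuous_pt, derivable_pt_id.
  - exists t; lra.
Qed.

(** Root of [u ^ 2 - c * u + d], that is, of [u + d / u = c] for nonzero [u]. *)
Definition larger_root (c d : R) : R := (c + sqrt (c ^ 2 - 4 * d)) / 2.

Lemma root_condition (m c d : R) :
  0 < m -> d / m + m <= c -> d + m ^ 2 <= c * m.
Proof.
  intros hm hc.
  replace (d + m ^ 2) with ((d / m + m) * m) by (field; lra).
  apply Rmult_le_compat_r; lra.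
Qed.

(** The quadratic is nonpositive at [m], so [d <= c * m - m ^ 2] and the discriminant is at least
    [(c - 2 * m) ^ 2]. *)
Lemma discriminant_ge0 (m c d : R) :
  0 < m -> 0 <= d -> d / m + m <= c -> 0 <= c ^ 2 - 4 * d.
Proof.
  intros hm hd hc. pose proof (root_condition m c d hm hc).
  pose proof (pow2_ge_0 (c - 2 * m)). nra.
Qed.

(** A point where the quadratic is nonpositive lies between the roots, which gives the lower bound.
    The upper bound holds because [d >= 0] makes the square root of the discriminant at most [c]. *)
Lemma larger_root_spec (m c d : R) :
  0 < m -> 0 <= d -> d / m + m <= c ->
  m <= larger_root c d <= c /\
  c - d / larger_root c d = larger_root c d.
Proof.
  intros hm hd hc.
  pose proof (root_condition m c d hm hc) as hmc.
  pose proof (discriminant_ge0 m c d hm hd hc) as hdisc.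
  assert (c0 : 0 < c) by nra.
  assert (hs := pow2_sqrt _ hdisc). assert (s0 := sqrt_pos (c ^ 2 - 4 * d)).
  unfold larger_root.
  set (s := sqrt (c ^ 2 - 4 * d)) in *.
  assert (m <= (c + s) / 2).
  { destruct (Rle_lt_dec (2 * m) c); [lra |].
    assert (2 * m - c <= s); [| lra].
    apply Rsqr_incr_0_var; unfold Rsqr; nra. }
  assert ((c + s) / 2 <= c) by (assert (s <= c) by nra; lra).
  repeat split; try assumption.
  assert (hu : 0 < (c + s) / 2) by lra.
  apply Rmult_eq_reg_r with ((c + s) / 2); [| lra].
  replace ((c - d / ((c + s) / 2)) * ((c + s) / 2))
    with (c * ((c + s) / 2) - d) by (field; lra).
  nra.
Qed.

(** A double root is allowed: [sqrt] is 0 on negative reals, hence continuous at 0 from both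
    sides. *)
Lemma continuity_pt_larger_root (c : R -> R) (d t : R) :
  continuity_pt c t -> 0 <= c t ^ 2 - 4 * d ->
  continuity_pt (fun s => larger_root (c s) d) t.
Proof.
  intros hc hd. unfold larger_root, Rdiv.
  apply (continuity_pt_mult (fun s => c s + sqrt (c s ^ 2 - 4 * d)) (fun _ => / 2));
    [| now apply continuity_pt_const; intros ? ?].
  apply (continuity_pt_plus c (fun s => sqrt (c s ^ 2 - 4 * d))); [exact hc |].
  apply (continuity_pt_comp (fun s => c s ^ 2 - 4 * d) sqrt);
    [| now apply continuity_pt_sqrt].
  apply (continuity_pt_minus (fun s => c s ^ 2) (fun _ => 4 * d));
    [| now apply continuity_pt_const; intros ? ?].
  apply (continuity_pt_comp c (fun x => x ^ 2)); [exact hc |].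
  apply derivable_continuous_pt, derivable_pt_pow.
Qed.

Lemma continuity_pt_cos_of_sin (t : R) :
  t ^ 2 <= 1 -> continuity_pt (fun s => sqrt (1 - s ^ 2)) t.
Proof.
  intros ht.
  apply (continuity_pt_comp (fun s => 1 - s ^ 2) sqrt);
    [| apply continuity_pt_sqrt; lra].
  apply (continuity_pt_minus (fun _ => 1) (fun s => s ^ 2));
    [now apply continuity_pt_const; intros ? ? |].
  apply derivable_continuous_pt, derivable_pt_pow.
Qed.

Lemma cos_of_sin_bounds (K t : R) :
  Rabs t <= K -> sqrt (1 - K ^ 2) <= sqrt (1 - t ^ 2) <= 1.
Proof.
  intros ht. assert (t ^ 2 <= K ^ 2) by now apply pow_maj_Rabs.
  split; [apply sqrt_le_1_alt; lra |].
  rewrite <- sqrt_1 at 2. apply sqrt_le_1_alt. pose proof (pow2_ge_0 t); lra.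
Qed.

Lemma Rabs_le_between (x K : R) : Rabs x <= K <-> - K <= x <= K.
Proof. split; [| apply Rabs_le]. unfold Rabs; destruct (Rcase_abs x); lra. Qed.

(** The first two terms are nonnegative and at most their values in the condition; the subtracted
    term lies in [[0, rt]], and the condition forces [rt <= K1]. *)
Lemma psi_bounds (p r rt K1 K2 psi x : R) :
  0 <= p -> 0 <= r -> 0 <= rt -> K2 < 1 ->
  p / (1 - K2) + r * (1 + K2) + rt <= K1 ->
  Rabs psi <= K1 -> Rabs x <= K2 ->
  Rabs (p / (x + 1) + r * (x + 1) - rt * sqrt (1 - psi ^ 2)) <= K1.
Proof.
  intros hp hr hrt hK2 hcond hpsi hx.
  apply Rabs_le_between in hx.
  destruct (cos_of_sin_bounds K1 psi hpsi) as [_ hs1].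
  assert (hs0 := sqrt_pos (1 - psi ^ 2)).
  assert (0 <= p / (x + 1)) by (apply Rle_mult_inv_pos; lra).
  assert (p / (x + 1) <= p / (1 - K2))
    by (apply Rmult_le_compat_l; [lra | apply Rinv_le_contravar; lra]).
  assert (0 <= r * (x + 1) <= r * (1 + K2)) by (split; nra).
  assert (0 <= rt * sqrt (1 - psi ^ 2) <= rt) by (split; nra).
  apply Rabs_le; lra.
Qed.

Lemma cos_minus_bounds (rt K psi : R) :
  0 <= rt -> Rabs psi <= K ->
  sqrt (1 - K ^ 2) - rt * K <= sqrt (1 - psi ^ 2) - rt * psi <= 1 + rt * K.
Proof.
  intros hrt hpsi. destruct (cos_of_sin_bounds K psi hpsi).
  apply Rabs_le_between in hpsi. split; nra.
Qed.

(** The lower bound is the worst case [x = - K2], [psi = K1]. Above, dropping the [q] term leaves at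
    most [rt * K1]. *)
Lemma x_bounds (q rt K1 K2 psi x : R) :
  0 <= q -> 0 <= rt -> K2 < 1 ->
  q / (1 - K2) + (1 - K2) <= sqrt (1 - K1 ^ 2) - rt * K1 ->
  rt * K1 <= K2 ->
  Rabs psi <= K1 -> Rabs x <= K2 ->
  Rabs (- (q / (x + 1)) - rt * psi + sqrt (1 - psi ^ 2) - 1) <= K2.
Proof.
  intros hq hrt hK2 hcond hrtK hpsi hx.
  destruct (cos_minus_bounds rt K1 psi hrt hpsi).
  apply Rabs_le_between in hx.
  assert (0 <= q / (x + 1)) by (apply Rle_mult_inv_pos; lra).
  assert (q / (x + 1) <= q / (1 - K2))
    by (apply Rmult_le_compat_l; [lra | apply Rinv_le_contravar; lra]).
  apply Rabs_le; lra.
Qed.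

Lemma two_bus_fixed_point (p q r rt K1 K2 : R) :
  0 <= p -> 0 <= q -> 0 <= r -> 0 <= rt -> 0 <= K1 <= 1 -> K2 < 1 ->
  p / (1 - K2) + r * (1 + K2) + rt <= K1 ->
  q / (1 - K2) + (1 - K2) <= sqrt (1 - K1 ^ 2) - rt * K1 ->
  rt * K1 <= K2 ->
  exists psi x, Rabs psi <= K1 /\ Rabs x <= K2 /\
    p / (x + 1) + r * (x + 1) - rt * sqrt (1 - psi ^ 2) = psi /\
    - (q / (x + 1)) - rt * psi + sqrt (1 - psi ^ 2) - 1 = x.
Proof.
  intros hp hq hr hrt hK1 hK2 h1 h2 h3.
  set (c := fun psi => sqrt (1 - psi ^ 2) - rt * psi).
  set (u := fun psi => larger_root (c psi) q).
  assert (hc : forall psi, - K1 <= psi <= K1 ->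
            q / (1 - K2) + (1 - K2) <= c psi <= 1 + K2).
  { intros psi hpsi.
    destruct (cos_minus_bounds rt K1 psi hrt (Rabs_le _ _ hpsi)).
    unfold c; lra. }
  (* The root lies in [[1 - K2, c psi]], and [c psi <= 1 + K2], so [x = u psi - 1] is admissible. *)
  assert (hu : forall psi, - K1 <= psi <= K1 ->
            Rabs (u psi - 1) <= K2 /\ 0 < u psi /\ c psi - q / u psi = u psi).
  { intros psi hpsi. destruct (hc psi hpsi) as [hcl hcu].
    destruct (larger_root_spec (1 - K2) (c psi) q) as [hb he]; try lra.
    fold (u psi) in hb, he.
    repeat split; [apply Rabs_le | | exact he]; lra. }
  destruct (interval_fixed_point
    (fun psi => p / u psi + r * u psi - rt * sqrt (1 - psi ^ 2)) (- K1) K1)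
    as [psi [hpsi hfix]].
  - lra.
  - intros t ht. destruct (hu t ht) as [_ [hut _]]. destruct (hc t ht) as [hcl _].
    assert (ht2 : t ^ 2 <= 1) by nra.
    assert (cu : continuity_pt u t).
    { apply (continuity_pt_larger_root c q t).
      - apply (continuity_pt_minus (fun s => sqrt (1 - s ^ 2)) (fun s => rt * s)).
        + now apply continuity_pt_cos_of_sin.
        + apply (continuity_pt_scal (fun s => s)).
          apply derivable_continuous_pt, derivable_pt_id.
      - apply (discriminant_ge0 (1 - K2)); lra. }
    apply (continuity_pt_minus (fun s => p / u s + r * u s)
             (fun s => rt * sqrt (1 - s ^ 2))).
    + apply (continuity_pt_plus (fun s => p / u s) (fun s => r * u s)).
      * apply (continuity_pt_div (fun _ => p) u); [| exact cu | lra].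
        now apply continuity_pt_const; intros ? ?.
      * now apply (continuity_pt_scal u).
    + apply (continuity_pt_scal (fun s => sqrt (1 - s ^ 2))).
      now apply continuity_pt_cos_of_sin.
  (* The reduced map is the first component at [x = u t - 1], so [psi_bounds] makes it a
     self-map. *)
  - intros t ht. destruct (hu t ht) as [hx _].
    apply Rabs_le_between.
    replace (u t) with (u t - 1 + 1) by ring.
    apply (psi_bounds p r rt K1 K2); try assumption. now apply Rabs_le.
  - destruct (hu psi hpsi) as [hx [_ he]].
    exists psi, (u psi - 1).
    replace (u psi - 1 + 1) with (u psi) by ring.
    repeat split; [now apply Rabs_le | exact hx | exact hfix |].
    unfold c in he; lra.
Qed.

Lemma k_mu_pos (N : two_bus) (mu : perturbation) :
  series_b N > 0 -> hat_b N mu > 0 -> tilde_b N mu > 0 -> 0 < k_mu N mu.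
Proof.
  intros hb hh ht. unfold k_mu, Rdiv.
  apply Rmult_lt_0_compat; [nra | apply Rinv_0_lt_compat, pow_lt, ht].
Qed.

Theorem proposition1 (N : two_bus) (mu : perturbation)
  (b_pos : series_b N > 0) (V_pos : slack_V N > 0)
  (tap_gt : tap mu > -1)
  (hat_b_pos : hat_b N mu > 0) (tilde_b_pos : tilde_b N mu > 0)
  (rho_ge0 : rho N mu >= 0) (tilde_rho_ge0 : tilde_rho N mu >= 0)
  (gamma_P_neg : gamma_P N < 0) (gamma_Q_le0 : gamma_Q N <= 0)
  (loading : 0 < 4 * (gamma_P N) ^ 2 - 4 * gamma_Q N < 1)
  (eps1 eps2 : R)
  (heps1 : 0 <= eps1 <= 1 - k1m N)
  (heps2 : 0 <= eps2 < 1 - k2m N)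
  (cond1 : - k_mu N mu * gamma_P N / (1 - k2m N - eps2)
           + gamma_P N / (1 - k2m N)
           + rho N mu * (1 + k2m N + eps2) + tilde_rho N mu <= eps1)
  (cond2 : - k_mu N mu * gamma_Q N / (1 - k2m N - eps2)
           + (1 - k2m N) + tilde_rho N mu * (k1m N + eps1)
           - sqrt (1 - (k1m N + eps1) ^ 2) <= eps2) :
  F_invariant N mu (Aset N eps1 eps2) /\
  exists xi : R * R, Aset N eps1 eps2 xi /\ power_flow_solution N mu xi.
Proof.
  pose proof (k_mu_pos N mu b_pos hat_b_pos tilde_b_pos) as hk.
  set (K1 := k1m N + eps1) in *. set (K2 := k2m N + eps2).
  set (p := - k_mu N mu * gamma_P N) in *.
  set (q := - k_mu N mu * gamma_Q N) in *.
  assert (hp : 0 <= p) by (unfold p; nra).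
  assert (hq : 0 <= q) by (unfold q; nra).
  assert (hK2 : K2 < 1) by (unfold K2; lra).
  assert (hk1 : 0 <= k1m N) by (apply Rle_mult_inv_pos; lra).
  assert (hK1 : 0 <= K1 <= 1) by (unfold K1; lra).
  replace (1 - k2m N - eps2) with (1 - K2) in cond1, cond2 by (unfold K2; ring).
  (* The term [gamma_P N / (1 - k2m N)] in [cond1] is [- k1m N]; moved to the right it completes
     [eps1] to [K1]. *)
  assert (h1 : p / (1 - K2) + rho N mu * (1 + K2) + tilde_rho N mu <= K1).
  { replace (1 + K2) with (1 + k2m N + eps2) by (unfold K2; ring).
    unfold K1, k1m, Rdiv in *. lra. }
  assert (h2 : q / (1 - K2) + (1 - K2)
               <= sqrt (1 - K1 ^ 2) - tilde_rho N mu * K1) by (unfold K2 at 2; lra).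
  (* A consequence of [h2]: the [q] term is nonnegative and the square root is at most 1. *)
  assert (h3 : tilde_rho N mu * K1 <= K2).
  { assert (0 <= q / (1 - K2)) by (apply Rle_mult_inv_pos; lra).
    destruct (cos_of_sin_bounds K1 K1) as [_ hs]; [rewrite Rabs_right; lra | lra]. }
  assert (hx : forall psi x,
    k_mu N mu * gamma_Q N / (x + 1) - tilde_rho N mu * psi + sqrt (1 - psi ^ 2) - 1
    = - (q / (x + 1)) - tilde_rho N mu * psi + sqrt (1 - psi ^ 2) - 1)
    by (intros; unfold q, Rdiv; ring).
  assert (hinv : F_invariant N mu (Aset N eps1 eps2)).
  { intros [psi x] [hpsi hxK].
    change (Rabs psi <= K1) in hpsi. change (Rabs x <= K2) in hxK.
    assert (hpsi' : Rabs (psi_next N mu (psi, x)) <= K1)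
      by (apply (psi_bounds p _ _ K1 K2); lra).
    (* [x_bounds] is applied to the updated angle variable, whose bound is [hpsi']. *)
    assert (hx' : Rabs (x_next N mu (psi, x)) <= K2)
      by (unfold x_next; rewrite hx; apply (x_bounds q _ K1 K2); assumption || lra).
    repeat split; try assumption; cbn [fst snd]; try lra.
    apply Rabs_le_between in hxK; lra. }
  split; [exact hinv |].
  destruct (two_bus_fixed_point p q (rho N mu) (tilde_rho N mu) K1 K2)
    as (psi & x & hpsi & hxK & e1 & e2); try lra.
  assert (hA : Aset N eps1 eps2 (psi, x)) by now split.
  exists (psi, x). split; [exact hA |]. split; [exact (proj1 (hinv _ hA)) |].
  (* Once the first component is fixed, updated and current [psi] agree, so [e2] settles the
     second. *)
  assert (hn : psi_next N mu (psi, x) = psi) by exact e1.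
  unfold F, x_next. rewrite hn, hx. cbn [snd]. now rewrite e2.
Qed.
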